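(* Let $1\le i<j<k$ be integers and let $\sigma=\sigma_1\sigma_2\cdots\sigma_k$ be a permutation of $\{1,\dots,k\}$. Let $\tau=\tau_1\tau_2\cdots\tau_k$ where $\tau_{i+1},\dots,\tau_j$ is a permutation of $\sigma_{i+1},\dots,\sigma_j$ and $\tau_x=\sigma_x$ for $x\in[1,i]\cup[j+1,k]$. Suppose that for every integer $z$ with $\min(i,k-j)<z<k$ all of the following hold: $$\sigma_1\cdots\sigma_z\not\sim\sigma_{k-z+1}\cdots\sigma_k,\qquad \sigma_1\cdots\sigma_z\not\sim\tau_{k-z+1}\cdots\tau_k,$$ $$\tau_1\cdots\tau_z\not\sim\sigma_{k-z+1}\cdots\sigma_k,\qquad \tau_1\cdots\tau_z\not\sim\tau_{k-z+1}\cdots\tau_k.$$ Then the consecutive patterns $\sigma$ and $\tau$ are filling-shape-Wilf-equivalent: $\sigma\equiv_{\mathrm{fs}}\tau$.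
   Context: Two sequences of positive integers of the same length are order-isomorphic, $a_1\cdots a_k\sim b_1\cdots b_k$, if for all $p,q$ one has $a_p<a_q$ iff $b_p<b_q$. A vincular pattern of length $k$ is a pair $(\sigma,T)$ with $\sigma$ a permutation of $\{1,\dots,k\}$ and $T\subseteq\{1,\dots,k-1\}$. A consecutive pattern $\sigma_1\cdots\sigma_k$ (written without dashes) is the case $T=\{1,\dots,k-1\}$. Young diagrams are drawn in French notation: a Young diagram $D$ with $n$ columns and $m$ rows is a set of cells (column, row) in $\{1,\dots,n\}\times\{1,\dots,m\}$ such that if $(a,b)\in D$ then $(a',b')\in D$ for all $1\le a'\le a$, $1\le b'\le b$; the cell $(1,1)$ is at the bottom left. A filling of $D$ is a set of selected cells of $D$ with no two in the same column and no two in the same row. For a column $c$ containing a selected cell, let $\pi(c)$ be the row of that cell. A filling contains the vincular pattern $(\sigma,T)$ of length $k$ if there are columns $i_1<\cdots<i_k$ such that: $(i_1,\pi(i_1)),\dots,(i_k,\pi(i_k))$ are selected cells; $\pi(i_1)\cdots\pi(i_k)\sim\sigma_1\cdots\sigma_k$; $(i_p,\pi(i_q))\in D$ for all $1\le p,q\le k$; and $i_{p+1}-i_p=1$ for all $p\in T$. Otherwise it avoids the pattern. Two vincular patterns $\sigma,\tau$ are filling-shape-Wilf-equivalent, $\sigma\equiv_{\mathrm{fs}}\tau$, if for every Young diagram $D$, every set $R$ of rows and every set $C$ of columns, the number of fillings of $D$ avoiding $\sigma$ whose set of rows without a selected cell is exactly $R$ and whose set of columns without a selected cell is exactly $C$ equals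 the number of such fillings avoiding $\tau$. *)

(* Defs.v *)
From mathcomp Require Import all_boot all_fingroup.

Set Implicit Arguments.
Unset Strict Implicit.
Unset Printing Implicit Defensive.

(* Positions, values, columns and rows are all numbered from 0, so that
   position p, column c or row r here is p+1, c+1 or r+1 in the usual
   1-based notation. *)

Definition order_iso (a b : seq nat) : bool :=
  (size a == size b) &&
  [forall p : 'I_(size a), forall q : 'I_(size a),
     (nth 0 a p < nth 0 a q) == (nth 0 b p < nth 0 b q)].

Definition word k (s : 'S_k) : seq nat := [seq val (s p) | p <- enum 'I_k].

(* An element t of vadj requires the columns playing positions t and t.+1 to be
   adjacent. *)
Record vincular (k : nat) :=
  Vincular { vperm : 'S_k; vadj : {set 'I_k.-1} }.

Definition consecutive k (s : 'S_k) : vincular k := Vincular s [set: 'I_k.-1].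

Section Fillings.

Variables n m : nat.

(* A cell is a pair (column, row). *)
Implicit Types D F : {set 'I_n * 'I_m}.

Definition young D : bool :=
  [forall a : 'I_n, forall b : 'I_m, forall a' : 'I_n, forall b' : 'I_m,
     [&& (a, b) \in D, a' <= a & b' <= b] ==> ((a', b') \in D)].

Definition filling D F : bool :=
  (F \subset D) &&
  [forall x in F, forall y in F,
     ((x.1 == y.1) || (x.2 == y.2)) ==> (x == y)].

(* c p is the column playing position p of the pattern, and r p is the row of
   the selected cell in that column, unique when F is a filling. *)
Definition occurrence D F k (v : vincular k)
    (c : {ffun 'I_k -> 'I_n}) (r : {ffun 'I_k -> 'I_m}) : bool :=
  [&& [forall p : 'I_k, forall q : 'I_k, (p < q) ==> (c p < c q)],
      [forall p : 'I_k, (c p, r p) \in F],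
      order_iso [seq val (r p) | p <- enum 'I_k] (word (vperm v)),
      [forall p : 'I_k, forall q : 'I_k, (c p, r q) \in D]
    & [forall t in vadj v, forall p : 'I_k, forall q : 'I_k,
         ((p == t :> nat) && (q == t.+1 :> nat)) ==>
         (c q == (c p).+1 :> nat)]].

Definition contains D F k (v : vincular k) : bool :=
  [exists c : {ffun 'I_k -> 'I_n}, exists r : {ffun 'I_k -> 'I_m},
     occurrence D F v c r].

Definition empty_rows F : {set 'I_m} :=
  [set r | [forall c : 'I_n, (c, r) \notin F]].

Definition empty_cols F : {set 'I_n} :=
  [set c | [forall r : 'I_m, (c, r) \notin F]].

Definition avoiders D k (v : vincular k) (R : {set 'I_m}) (C : {set 'I_n}) :
    {set {set 'I_n * 'I_m}} :=
  [set F | [&& filling D F, ~~ contains D F v,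
               empty_rows F == R & empty_cols F == C]].

End Fillings.

Definition fs_equiv k l (v : vincular k) (w : vincular l) : Prop :=
  forall (n m : nat) (D : {set 'I_n * 'I_m}), young D ->
  forall (R : {set 'I_m}) (C : {set 'I_n}),
    #|avoiders D v R C| = #|avoiders D w R C|.

(* Main.v *)
(** An occurrence of [sigma] becomes an occurrence of [tau], and conversely, when
    the columns of its middle segment [i, j) are rearranged. By the overlap
    hypothesis two occurrences of [sigma] or [tau] share at most
    [min(i, k - j)] columns, so no occurrence meets the middle segment of
    another one, and exchanging [sigma] and [tau] at one place affects neither
    the other occurrences, nor the set of nonempty rows or columns. Doing this at
    all places, one after the other, is an injection of the fillings which
    exchanges the avoiders of the two patterns. *)

Require Import Defs.
From mathcomp Require Import all_boot all_fingroup.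
From mathcomp Require Import zify.

Set Implicit Arguments.
Unset Strict Implicit.
Unset Printing Implicit Defensive.

(** * Words of permutations and order isomorphism *)

Lemma nth_word k (s : 'S_k) (p : 'I_k) : nth 0 (word s) p = s p.
Proof. by rewrite (nth_map p) ?size_enum_ord // nth_ord_enum. Qed.

Lemma size_word k (s : 'S_k) : size (word s) = k.
Proof. by rewrite size_map size_enum_ord. Qed.

Lemma order_isoP z (a b : seq nat) : size a = z -> size b = z ->
  reflect (forall p q, p < z -> q < z ->
             (nth 0 a p < nth 0 a q) = (nth 0 b p < nth 0 b q))
          (order_iso a b).
Proof.
move=> <- szb; rewrite /order_iso szb eqxx /=.
apply: (iffP forallP) => [h p q ltp ltq | h p].
  by have /forallP/(_ (Ordinal ltq))/eqP := h (Ordinal ltp).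
by apply/forallP=> q; apply/eqP; apply: h.
Qed.

(** Values start at 0, so each value of a permutation is the number of smaller values, and this
    count depends on the relative order only. *)
Lemma perm_order_inj k (s t : 'S_k) :
  (forall p q, (s p < s q) = (t p < t q)) -> s = t.
Proof.
have rank (u : 'S_k) p : #|[pred q | u q < u p]| = u p.
  rewrite -(card_imset _ (@perm_inj _ u)) /=.
  (* The values below [u p] form the image of ['I_(u p)] in ['I_k], which has [u p] elements. *)
  have wide_inj : injective (widen_ord (ltnW (ltn_ord (u p)))).
    by move=> x y /(congr1 val) e; apply: val_inj.
  rewrite -[RHS]card_ord -(card_imset _ wide_inj).
  apply: eq_card => y; apply/imsetP/imsetP => [[q hq ->] | [x _ ->]].
    by exists (Ordinal (hq : u q < u p)) => //; apply: val_inj.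
  exists (u^-1%g (widen_ord (ltnW (ltn_ord (u p))) x)); last by rewrite permKV.
  by rewrite inE permKV /=.
move=> h; apply/permP=> p; apply: val_inj; rewrite /= -[LHS]rank -[RHS]rank.
by apply: eq_card => q; rewrite !inE h.
Qed.

(** * Permuting the columns of a place [c] *)

Section Recolumn.

Variables n m k : nat.
Implicit Types (c : {ffun 'I_k -> 'I_n}) (u : 'S_k) (F D : {set 'I_n * 'I_m}).

Definition recol_fun c u (x : 'I_n) : 'I_n :=
  if [pick p | c p == x] is Some p then c (u p) else x.

(** Taken as a preimage: column [c p] receives the cells of column [c (u p)], and rows are kept. *)
Definition recol c u F := [set x | (recol_fun c u x.1, x.2) \in F].

Lemma recol_fun_in c u p : injective c -> recol_fun c u (c p) = c (u p).
Proof.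
by move=> ic; rewrite /recol_fun; case: pickP => [q /eqP/ic-> | /(_ p)/eqP].
Qed.

Lemma recol_fun_out c u x : (forall p, c p != x) -> recol_fun c u x = x.
Proof. by rewrite /recol_fun; case: pickP => // p /eqP <- /(_ p)/eqP. Qed.

Lemma recol_fun_cases c u x : injective c ->
  (exists2 p, x = c p & recol_fun c u x = c (u p)) \/
  (forall p, c p != x) /\ recol_fun c u x = x.
Proof.
move=> ic; have [/existsP[p /eqP <-] | nx] := boolP [exists p, c p == x].
  by left; exists p; rewrite ?recol_fun_in.
have out p : c p != x by apply: contra nx => e; apply/existsP; exists p.
by right; rewrite recol_fun_out.
Qed.

Lemma recol_funK c u : injective c ->
  cancel (recol_fun c u) (recol_fun c u^-1%g).
Proof.
move=> ic x; have [[p -> ->]|[out ->]] := recol_fun_cases u x ic.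
  by rewrite recol_fun_in // permK.
exact: recol_fun_out.
Qed.

End Recolumn.

(** * Occurrences of consecutive patterns at a fixed place *)

Section Swap.

Variables (n m k : nat) (D : {set 'I_n * 'I_m}).
Implicit Types (c : {ffun 'I_k -> 'I_n}) (s t u : 'S_k) (F : {set 'I_n * 'I_m}).

Definition occurs F s c :=
  [exists r : {ffun 'I_k -> 'I_m}, occurrence D F (consecutive s) c r].

(** The first clause says without subtraction that [c p - p] is constant; it replaces both
    monotonicity and adjacency of the columns. *)
Lemma occursP F s c :
  reflect (exists r : 'I_k -> 'I_m,
             [/\ forall p q : 'I_k, c p + q = c q + p,
                 forall p, (c p, r p) \in F,
                 forall p q, (r p < r q) = (s p < s q)
               & forall p q, (c p, r q) \in D])
          (occurs F s c).
Proof.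
have sz (r : 'I_k -> 'I_m) : size [seq val (r p) | p <- enum 'I_k] = k.
  by rewrite size_map size_enum_ord.
have nth_r (r : 'I_k -> 'I_m) (p : 'I_k) :
    nth 0 [seq val (r p) | p <- enum 'I_k] p = r p.
  by rewrite (nth_map p) ?size_enum_ord // nth_ord_enum.
apply: (iffP existsP) => [[r /and5P[_ inF iso inD adj]] | [r [step inF iso inD]]].
  exists r; split; last 1 first.
  - by move=> p q; move/forallP/(_ p)/forallP: inD; apply.
  - have next (p q : 'I_k) : q = p.+1 :> nat -> c q = (c p).+1 :> nat.
      move=> eq_q; have lt_p : p < k.-1 by have := ltn_ord q; lia.
      have /forall_inP/(_ (Ordinal lt_p) (in_setT _)) := adj.
      by move=> /forallP/(_ p)/forallP/(_ q); rewrite eqxx eq_q eqxx => /eqP.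
    (* Adjacency of neighbours is iterated over the distance [d]. *)
    have far d (p q : 'I_k) : q = p + d :> nat -> c q = c p + d :> nat.
      elim: d q => [|d IHd] q eq_q.
        have -> : q = p by apply: val_inj; rewrite /= eq_q addn0.
        by rewrite addn0.
      have lt_d : p + d < k by have := ltn_ord q; lia.
      rewrite addnS -(IHd (Ordinal lt_d)) //; apply: next.
      by rewrite eq_q addnS.
    move=> p q; case: (leqP p q) => le_pq.
      by have := far (q - p) p q; lia.
    by have := far (p - q) q p; lia.
  - by move=> p; move/forallP: inF.
  - move=> p q; have := elimT (order_isoP (sz r) (size_word s)) iso p q.
    by rewrite !nth_r !nth_word => ->.
exists (finfun r); have rE p : finfun r p = r p by rewrite ffunE.
apply/and5P; split.
- by apply/forallP=> p; apply/forallP=> q; apply/implyP; have := step p q; lia.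
- by apply/forallP=> p; rewrite rE.
- apply/(order_isoP (sz _) (size_word _)) => p q ltp ltq.
  rewrite (nth_r _ (Ordinal ltp)) (nth_r _ (Ordinal ltq)) !rE.
  by rewrite (nth_word _ (Ordinal ltp)) (nth_word _ (Ordinal ltq)).
- by apply/forallP=> p; apply/forallP=> q; rewrite rE.
- apply/forall_inP=> x _; apply/forallP=> p; apply/forallP=> q.
  by apply/implyP=> /andP[/eqP ep /eqP eq]; apply/eqP; have := step p q; lia.
Qed.

Lemma contains_occurs F s : contains D F (consecutive s) = [exists c, occurs F s c].
Proof. by []. Qed.

Lemma occurs_inj F s c : occurs F s c -> injective c.
Proof.
case/occursP=> r [step _ _ _] p q epq; apply: val_inj.
by have := step p q; rewrite epq /=; lia.
Qed.

Lemma fillingP F :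
  reflect [/\ forall x, x \in F -> x \in D,
              forall a b b', (a, b) \in F -> (a, b') \in F -> b = b'
            & forall a a' b, (a, b) \in F -> (a', b) \in F -> a = a']
          (filling D F).
Proof.
apply: (iffP andP) => [[/subsetP sub /forall_inP inj] | [sub injr injc]].
  split=> // [a b b' ab ab' | a a' b ab ab'].
    have /forall_inP/(_ _ ab') := inj _ ab.
    by rewrite /= eqxx /= => /eqP[].
  have /forall_inP/(_ _ ab') := inj _ ab.
  by rewrite /= eqxx orbT /= => /eqP[].
split; first exact/subsetP.
apply/forall_inP=> [[a b]] ab; apply/forall_inP=> [[a' b']] ab'.
apply/implyP=> /= /orP[] /eqP e; subst.
  by rewrite (injr _ _ _ ab ab').
by rewrite (injc _ _ _ ab ab').
Qed.

(** Column [c p] now has the row of the old position [s^-1 (t p)], whose rank under [s] is [t p]. *)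
Lemma recol_occurs F s t c :
  occurs F s c -> occurs (recol c (t * s^-1) F) t c.
Proof.
move=> occ; have ic := occurs_inj occ.
case/occursP: occ => r [step inF iso inD].
apply/occursP; exists (fun p => r ((t * s^-1)%g p)); split=> // [p|p q].
  by rewrite inE /= recol_fun_in.
by rewrite iso !permM !permKV.
Qed.

Lemma recolK F c u : injective c -> recol c u^-1 (recol c u F) = F.
Proof.
move=> ic; apply/setP=> [[x y]]; rewrite !inE /=.
by rewrite -{1}[u]invgK recol_funK.
Qed.

Lemma recol_filling F s c u : filling D F -> occurs F s c ->
  filling D (recol c u F).
Proof.
move=> /fillingP[sub injr injc] occ; have ic := occurs_inj occ.
case/occursP: occ => r [step inF iso inD].
apply/fillingP; split=> [[x y]|a b b'|a a' b]; rewrite !inE /=.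
- have [[p -> ->]|[_ ->]] := recol_fun_cases u x ic; last exact: sub.
  (* A moved cell stays in [D] because an occurrence requires all crossings of its columns and rows
     to lie in [D]. *)
  by move=> /(injr _ _ _ (inF _)) <-.
- exact: injr.
- by move=> h h'; apply: can_inj (recol_funK u ic) _ _ (injc _ _ _ h h').
Qed.

Lemma recol_empty_rows F c u : injective c ->
  empty_rows (recol c u F) = empty_rows F.
Proof.
move=> ic; apply/setP=> y; rewrite !inE.
apply/forallP/forallP => h x; last by rewrite inE /=.
have := h (recol_fun c u^-1%g x).
by rewrite inE /= -{1}[u]invgK recol_funK.
Qed.

(** All columns of the occurrence are nonempty before and after; the others are untouched. *)
Lemma recol_empty_cols F s c u : occurs F s c ->
  empty_cols (recol c u F) = empty_cols F.
Proof.
move=> occ; have ic := occurs_inj occ.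
case/occursP: occ => r [_ inF _ _].
apply/setP=> x; rewrite !inE.
have [[p -> e]|[_ e]] := recol_fun_cases u x ic; last first.
  by apply: eq_forallb => y; rewrite inE /= e.
transitivity false; [|symmetry]; apply/forallP.
  by move/(_ (r (u p))); rewrite inE /= e inF.
by move/(_ (r p)); rewrite inF.
Qed.

Lemma occurs_perm_inj F s t c : filling D F ->
  occurs F s c -> occurs F t c -> s = t.
Proof.
move=> /fillingP[_ injr _] /occursP[r [_ inF iso _]] /occursP[r' [_ inF' iso' _]].
by apply: perm_order_inj => p q; rewrite -iso -iso' !(injr _ _ _ (inF _) (inF' _)).
Qed.

(** On the [k - d] shared columns both occurrences use the same selected cells, since a filling has
    at most one per column. *)
Lemma occurs_order_iso F s t c c' d : filling D F ->
  occurs F s c -> occurs F t c' -> d <= k ->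
  (forall p q : 'I_k, p = d + q :> nat -> c p = c' q) ->
  order_iso (take (k - d) (word t)) (drop d (word s)).
Proof.
move=> /fillingP[_ injr _] /occursP[r [_ inF iso _]] /occursP[r' [_ inF' iso' _]].
move=> led shift.
apply/(@order_isoP (k - d)); rewrite ?size_takel ?size_drop ?size_word ?leq_subr //.
move=> p q ltp ltq; rewrite !nth_take // !nth_drop.
have [ltp1 ltp2 ltq1 ltq2] : [/\ p < k, d + p < k, q < k & d + q < k].
  by split; lia.
rewrite (nth_word t (Ordinal ltp1)) (nth_word t (Ordinal ltq1)).
rewrite (nth_word s (Ordinal ltp2)) (nth_word s (Ordinal ltq2)).
rewrite -iso -iso'.
have rE x (h1 : x < k) (h2 : d + x < k) : r (Ordinal h2) = r' (Ordinal h1).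
  apply: injr (inF _) _.
  by rewrite (shift (Ordinal h2) (Ordinal h1)).
by rewrite (rE _ ltp1 ltp2) (rE _ ltq1 ltq2).
Qed.

(** * Overlaps of occurrences of the two patterns *)

Section Pair.

Variables (i j : nat) (sigma tau : 'S_k).
Hypotheses (hij : i < j) (hjk : j < k).

Let pats := pred2 sigma tau.

Hypothesis hout : forall x : 'I_k, (x < i) || (j <= x) -> tau x = sigma x.
Hypothesis hoverlap : forall s t z, s \in pats -> t \in pats ->
  minn i (k - j) < z -> z < k ->
  ~~ order_iso (take z (word s)) (drop (k - z) (word t)).
Hypothesis neq_pats : sigma != tau.

(** A shared column in the middle of [c] would force an overlap of more than [minn i (k - j)]
    columns, which [hoverlap] forbids. *)
Lemma middle_disjoint F s t c c' (p q : 'I_k) : filling D F ->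
  s \in pats -> t \in pats -> occurs F s c -> occurs F t c' -> c' != c ->
  i <= p < j -> c p != c' q.
Proof.
move=> fill pats_s pats_t occ occ' neq hp.
have [r [step _ _ _]] := occursP _ _ _ occ.
have [r' [step' _ _ _]] := occursP _ _ _ occ'.
have k_gt0 : 0 < k by lia.
pose o : 'I_k := Ordinal k_gt0.
have eq_c x : c x = c o + x :> nat by have := step x o; rewrite /=; lia.
have eq_c' x : c' x = c' o + x :> nat by have := step' x o; rewrite /=; lia.
apply/eqP=> /(congr1 val) /=; rewrite eq_c eq_c' => meet.
have ltp := ltn_ord p; have ltq := ltn_ord q.
case: (ltngtP (c o) (c' o)) => cmp.
(* The shift is [p - q < j], so the overlap exceeds [k - j]. *)
- have := @hoverlap t s (k - (c' o - c o)) pats_t pats_s.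
  rewrite subKn; last by lia.
  rewrite (occurs_order_iso fill occ occ'); [|by lia|]; first by lia.
  by move=> x y e; apply: val_inj; rewrite /= eq_c eq_c'; lia.
(* The shift is [q - p < k - i], so the overlap exceeds [i]. *)
- have := @hoverlap s t (k - (c o - c' o)) pats_s pats_t.
  rewrite subKn; last by lia.
  rewrite (occurs_order_iso fill occ' occ); [|by lia|]; first by lia.
  by move=> x y e; apply: val_inj; rewrite /= eq_c eq_c'; lia.
- case/eqP: neq; apply/ffunP=> x; apply: val_inj.
  by rewrite /= eq_c eq_c' cmp.
Qed.

Definition fixes_ends u := forall x : 'I_k, (x < i) || (j <= x) -> u x = x.

Lemma fixes_ends_div s t : s \in pats -> t \in pats -> fixes_ends (t * s^-1).
Proof.
have hpat u (x : 'I_k) : u \in pats -> (x < i) || (j <= x) -> u x = sigma x.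
  by case/pred2P=> -> // /hout.
move=> ps pt x hx; apply: (@perm_inj _ s).
by rewrite permM permKV !hpat.
Qed.

(** A column of [c'] that lies in [c] sits at an end position of [c], which [u] fixes, so its cell
    does not move. *)
Lemma recol_other F s t c c' u : filling D F ->
  s \in pats -> t \in pats -> fixes_ends u -> occurs F s c -> c' != c ->
  occurs F t c' -> occurs (recol c u F) t c'.
Proof.
move=> fill ps pt fixu occ neq occ'; have ic := occurs_inj occ.
have mid := middle_disjoint _ fill ps pt occ occ' neq.
case/occursP: occ' => r [step inF iso inD]; apply/occursP; exists r; split=> // q.
rewrite inE /=; have [[p e ->]|[_ ->]] := recol_fun_cases u (c' q) ic; last exact: inF.
have [hp|hp] := boolP (i <= p < j); first by have := mid p q hp; rewrite e eqxx.
by rewrite fixu -?e //; lia.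
Qed.

(** * Exchanging the two patterns at one place *)

Definition swap c F :=
  if occurs F sigma c then recol c (tau * sigma^-1) F
  else if occurs F tau c then recol c (sigma * tau^-1) F else F.

Definition other s := if s == sigma then tau else sigma.

Lemma sigma_pats : sigma \in pats. Proof. by rewrite !inE eqxx. Qed.

Lemma tau_pats : tau \in pats. Proof. by rewrite !inE eqxx orbT. Qed.

Lemma other_sigma : other sigma = tau.
Proof. by rewrite /other eqxx. Qed.

Lemma other_tau : other tau = sigma.
Proof. by rewrite /other eq_sym (negPf neq_pats). Qed.

Lemma other_pats s : s \in pats -> other s \in pats.
Proof.
by case/pred2P=> ->; rewrite ?other_sigma ?other_tau ?sigma_pats ?tau_pats.
Qed.

Lemma otherK s : s \in pats -> other (other s) = s.
Proof. by case/pred2P=> ->; rewrite !(other_sigma, other_tau). Qed.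

Lemma swapE s c F : filling D F -> s \in pats -> occurs F s c ->
  swap c F = recol c (other s * s^-1) F.
Proof.
move=> fill /pred2P[] -> occ; rewrite /swap ?other_sigma ?other_tau occ //.
by case: ifP => // occ'; case/eqP: neq_pats; apply: occurs_perm_inj fill occ' occ.
Qed.

Lemma swap_id c F : (forall s, s \in pats -> ~~ occurs F s c) -> swap c F = F.
Proof.
move=> none; rewrite /swap.
by rewrite (negPf (none _ sigma_pats)) (negPf (none _ tau_pats)).
Qed.

Lemma swap_cases c F : filling D F ->
  (exists s, [/\ s \in pats, occurs F s c &
                 swap c F = recol c (other s * s^-1) F]) \/
  swap c F = F.
Proof.
move=> fill; have [/existsP[s /andP[ps occ]]|none] :=
  boolP [exists s, (s \in pats) && occurs F s c].
  by left; exists s; rewrite (swapE fill ps occ).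
right; apply: swap_id => s ps; apply: contra none => occ.
by apply/existsP; exists s; rewrite ps.
Qed.

Lemma swap_filling c F : filling D F -> filling D (swap c F).
Proof.
move=> fill; have [[s [_ occ ->]]|-> //] := swap_cases c fill.
exact: recol_filling occ.
Qed.

Lemma swap_empty_rows c F : filling D F -> empty_rows (swap c F) = empty_rows F.
Proof.
move=> fill; have [[s [_ occ ->]]|-> //] := swap_cases c fill.
exact: recol_empty_rows (occurs_inj occ).
Qed.

Lemma swap_empty_cols c F : filling D F -> empty_cols (swap c F) = empty_cols F.
Proof.
move=> fill; have [[s [_ occ ->]]|-> //] := swap_cases c fill.
exact: recol_empty_cols occ.
Qed.

(** After a swap the other pattern occurs at [c], so the second swap permutes the columns by the
    inverse permutation. *)
Lemma swapK c F : filling D F -> swap c (swap c F) = F.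
Proof.
move=> fill; have fill' := swap_filling c fill.
have [[s [ps occ e]]|e] := swap_cases c fill; last by rewrite !e.
have occ' : occurs (swap c F) (other s) c by rewrite e; apply: recol_occurs.
rewrite (swapE fill' (other_pats ps) occ') otherK // e.
by rewrite -[(s * _)%g]invgK invMg invgK recolK //; apply: occurs_inj occ.
Qed.

Lemma occurs_swap_imp c c' t F : filling D F -> t \in pats ->
  occurs F t c' -> occurs (swap c F) (if c' == c then other t else t) c'.
Proof.
move=> fill pt; case: eqP => [->|/eqP neq] occ'.
  by rewrite (swapE fill pt occ'); apply: recol_occurs.
have [[s [ps occ ->]]|-> //] := swap_cases c fill.
have fixu := fixes_ends_div ps (other_pats ps).
exact: (recol_other fill ps pt fixu occ neq occ').
Qed.

(** The converse of [occurs_swap_imp] is the same implication applied to [swap c F], since [swap c]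
    is an involution. *)
Lemma occurs_swap c c' t F : filling D F -> t \in pats ->
  occurs (swap c F) t c' = occurs F (if c' == c then other t else t) c'.
Proof.
move=> fill pt; apply/idP/idP => [|occ].
  by move/(occurs_swap_imp c (swap_filling c fill) pt); rewrite swapK.
have pt' : (if c' == c then other t else t) \in pats.
  by case: ifP => // _; apply: other_pats.
have := occurs_swap_imp c fill pt' occ; case: eqP => _; rewrite ?otherK //.
Qed.

(** * Exchanging the patterns at all places *)

Let swaps cs F := foldr swap F cs.

Lemma swaps_filling cs F : filling D F -> filling D (swaps cs F).
Proof. by elim: cs => //= c cs IH /IH/(swap_filling c). Qed.

Lemma swaps_empty_rows cs F : filling D F ->
  empty_rows (swaps cs F) = empty_rows F.
Proof.
by move=> fill; elim: cs => //= c cs IH; rewrite swap_empty_rows ?swaps_filling.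
Qed.

Lemma swaps_empty_cols cs F : filling D F ->
  empty_cols (swaps cs F) = empty_cols F.
Proof.
by move=> fill; elim: cs => //= c cs IH; rewrite swap_empty_cols ?swaps_filling.
Qed.

Lemma swaps_inj cs F F' : filling D F -> filling D F' ->
  swaps cs F = swaps cs F' -> F = F'.
Proof.
move=> fill fill'; elim: cs => //= c cs IH /(congr1 (swap c)).
by rewrite !swapK ?swaps_filling.
Qed.

(** A swap changes the occurrences of the two patterns at its own place only, and [uniq] ensures
    that no place is swapped twice. *)
Lemma occurs_swaps cs c t F : filling D F -> t \in pats -> uniq cs ->
  occurs (swaps cs F) t c = occurs F (if c \in cs then other t else t) c.
Proof.
move=> fill; elim: cs c t => //= c0 cs IH c t pt /andP[c0cs ucs].
rewrite occurs_swap ?swaps_filling // in_cons.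
have [-> | neq] /= := eqVneq c c0; last exact: IH.
by rewrite IH ?other_pats // (negPf c0cs).
Qed.

Lemma contains_swaps t F : filling D F -> t \in pats ->
  contains D (swaps (enum {ffun 'I_k -> 'I_n}) F) (consecutive t) =
  contains D F (consecutive (other t)).
Proof.
move=> fill pt; rewrite !contains_occurs; apply: eq_existsb => c.
by rewrite occurs_swaps ?enum_uniq // mem_enum.
Qed.

(** Swapping at every possible place maps the first set injectively into the second. Taking [t] to
    be each pattern in turn gives both inequalities. *)
Lemma leq_card_avoiders t R C : t \in pats ->
  #|avoiders D (consecutive (other t)) R C| <= #|avoiders D (consecutive t) R C|.
Proof.
move=> pt; pose f := swaps (enum {ffun 'I_k -> 'I_n}).
rewrite -(card_in_imset (f := f)); last first.
  move=> F F'; rewrite !inE => /and4P[fill _ _ _] /and4P[fill' _ _ _].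
  exact: swaps_inj.
apply/subset_leq_card/subsetP=> _ /imsetP[F + ->].
rewrite !inE => /and4P[fill avoid rows cols].
rewrite contains_swaps // avoid swaps_filling //.
by rewrite swaps_empty_rows // swaps_empty_cols // rows cols.
Qed.

End Pair.

End Swap.

Theorem theorem3p5 (i j k : nat) (sigma tau : 'S_k)
    (hi : 1 <= i) (hij : i < j) (hjk : j < k)
    (hmid : perm_eq (take (j - i) (drop i (word tau)))
                    (take (j - i) (drop i (word sigma))))
    (hout : forall x : 'I_k, (x < i) || (j <= x) -> tau x = sigma x)
    (hoverlap : forall z : nat, minn i (k - j) < z -> z < k ->
       [/\ ~~ order_iso (take z (word sigma)) (drop (k - z) (word sigma)),
           ~~ order_iso (take z (word sigma)) (drop (k - z) (word tau)),
           ~~ order_iso (take z (word tau)) (drop (k - z) (word sigma))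
         & ~~ order_iso (take z (word tau)) (drop (k - z) (word tau))]) :
  fs_equiv (consecutive sigma) (consecutive tau).
Proof.
(* Equal patterns are set apart: [other] exchanges [sigma] and [tau] only when they differ. *)
move=> n m D _ R C; have [-> //|neq] := eqVneq sigma tau.
have overlap s t z : s \in pred2 sigma tau -> t \in pred2 sigma tau ->
    minn i (k - j) < z -> z < k ->
    ~~ order_iso (take z (word s)) (drop (k - z) (word t)).
  by move=> /pred2P[]-> /pred2P[]-> lo hi'; case: (hoverlap z lo hi').
have le t := @leq_card_avoiders n m k D i j sigma tau hij hjk hout overlap neq t R C.
apply/eqP; rewrite eqn_leq; apply/andP; split.
  by have := le tau; rewrite other_tau //; apply; apply: tau_pats.
by have := le sigma; rewrite other_sigma //; apply; apply: sigma_pats.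
Qed.
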